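(* There is an absolute constant $c>0$ with the following property. Let $n\ge 1$ be an integer and let $0<\delta<1$ and $0<\epsilon<1$ be real numbers. Set $K=\left\lfloor \frac{c}{\sqrt{\delta}}\ln\frac{n}{\epsilon\sqrt{\delta}}\right\rfloor$. Then there exists a function $\Phi=\Phi_{n,\delta,\epsilon}:\mathbb{C}^{K+1}\to\mathbb{C}\setminus\{0\}$ such that for every nonzero polynomial $p(x)=a_0+a_1x+\dots+a_nx^n$ all of whose roots $x$ are real and satisfy $x\le-\delta$, the number $\Phi(a_0,a_1,\dots,a_K)$ approximates $p(1)$ within relative error $\epsilon$ (where $a_k:=0$ for $k>n$). In words: the value $p(1)$, up to relative error $\epsilon$, is determined by the coefficients $a_k$ with $k\le \frac{c}{\sqrt{\delta}}\ln\frac{n}{\epsilon\sqrt{\delta}}$.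
   Context: For nonzero complex numbers $a,b$, one says that $b$ approximates $a$ within relative error $\epsilon>0$ if one can write $a=e^{z}$ and $b=e^{w}$ for some complex numbers $z,w$ with $|z-w|\le\epsilon$. *)

(* Defs.v *)
From HB Require Import structures.
From mathcomp Require Import all_boot all_order all_algebra.
From mathcomp Require Import all_classical all_reals all_analysis.
From mathcomp.real_closed Require Import complex.

Set Implicit Arguments.
Unset Strict Implicit.
Unset Printing Implicit Defensive.

Import Order.TTheory GRing.Theory Num.Theory.

Local Open Scope ring_scope.
Local Open Scope complex_scope.

Definition cexp (R : realType) (z : R[i]) : R[i] :=
  (expR (complex.Re z))%:C * (cos (complex.Im z) +i* sin (complex.Im z)).

(* [b] approximates [a] within relative error [eps].  Both numbers are nonzero
   as values of [cexp]; the norm [`|z - w|] of [R[i]] is itself a (real)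
   element of [R[i]], hence the injection of [eps]. *)
Definition approximates (R : realType) (eps : R) (b a : R[i]) : Prop :=
  exists z w : R[i], [/\ a = cexp z, b = cexp w & `|z - w| <= eps%:C].

(* Main.v *)
(** Write [p = a_0 * prod (1 + t_i X)] with [n] numbers [t_i] in [[0, 1/delta]]
    (padding with [t_i = 0]), so that [p(1) = a_0 * exp (sum ln (1 + t_i))].
    The coefficients [a_0, ..., a_K] determine the power sums of the [t_i] up to
    order [K], hence [sum q(t_i)] for every polynomial [q] of degree at most
    [K]; it remains to approximate [ln (1 + t)] on [[0, 1/delta]] by such a [q]
    within [eps/2n].  Put [M = sqrt (1 + 1/delta)], [r = (M - 1)/(M + 1)] and
    [y = 2 delta t - 1].  Then [1 + t] is a constant multiple of
    [1 + 2 r y + r^2], whose logarithm is the Chebyshev series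
    [2 sum_(k >= 1) (-1)^(k-1) r^k T_k(y) / k], and [r <= exp (- 2/(M + 1))]
    with [M + 1 <= 3 / sqrt delta].  As [Phi] of a prefix one can take the value
    at [1] of any admissible polynomial with that prefix. *)

Require Import Defs.
From mathcomp Require Import all_boot all_order all_algebra.
From mathcomp Require Import all_classical all_reals all_analysis.
From mathcomp.real_closed Require Import complex.
From mathcomp Require Import ring lra.

Import Order.TTheory GRing.Theory Num.Theory.

Local Open Scope ring_scope.
Local Open Scope complex_scope.

(** * Power sums determined by leading coefficients *)

(* Newton's identities: modulo ['X^K], the logarithmic derivative of the product
   is the generating function of the signed power sums. *)
Lemma log_derivative_prod (F : fieldType) (K : nat) (ts : seq F) :
  'X^K %| (\prod_(t <- ts) (1 + t *: 'X))^`() -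
          \prod_(t <- ts) (1 + t *: 'X) * \sum_(t <- ts) \poly_(j < K) (t * (- t) ^+ j).
Proof.
elim: ts => [|t ts IH].
  by rewrite !big_nil mulr0 subr0 -polyC1 derivC dvdp0.
rewrite !big_cons; set e := \prod_(_ <- _) _; set S := \sum_(_ <- _) _.
have -> : \poly_(j < K) (t * (- t) ^+ j) = t *: \sum_(j < K) (- t *: 'X) ^+ j.
  rewrite poly_def scaler_sumr; apply: eq_bigr => j _.
  by rewrite exprZn scalerA.
set G := \sum_(_ < _) _.
(* [G] is the truncated geometric series of [t / (1 + t X)] up to the factor [t], so the new factor
   adds only a multiple of ['X^K] to the defect. *)
have geo : (1 + t *: 'X) * G = 1 - (- t) ^+ K *: 'X^K.
  rewrite -exprZn; have /(congr1 -%R) := subrX1 (- t *: 'X) K.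
  rewrite opprB => ->; rewrite -mulNr; congr (_ * _).
  by rewrite opprB scaleNr opprK.
have -> : ((1 + t *: 'X) * e)^`() - (1 + t *: 'X) * e * (t *: G + S) =
    (1 + t *: 'X) * (e^`() - e * S) + t *: ((- t) ^+ K *: e) * 'X^K.
  rewrite derivM derivD -polyC1 derivC derivZ derivX polyC1 add0r.
  have -> : (1 + t *: 'X) * e * (t *: G + S) =
    t *: e * ((1 + t *: 'X) * G) + (1 + t *: 'X) * (e * S).
    by rewrite -!mul_polyC; ring.
  by rewrite geo -!mul_polyC; ring.
by apply: dvdp_add; [exact: dvdp_mull | rewrite dvdp_mull].
Qed.

(** The products have constant term 1, hence are invertible modulo ['X^K]. Their logarithmic
    derivatives therefore agree there, and the generating functions, of degree below [K], are
    equal. *)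
Lemma power_sums_of_coefs (F : fieldType) (K : nat) (ts us : seq F) :
  (forall k, (k <= K)%N -> (\prod_(t <- ts) (1 + t *: 'X))`_k =
                          (\prod_(u <- us) (1 + u *: 'X))`_k) ->
  forall k, (0 < k <= K)%N -> \sum_(t <- ts) t ^+ k = \sum_(u <- us) u ^+ k.
Proof.
move=> eq_coef [//|k] /= ltkK.
have := log_derivative_prod F K ts; have := log_derivative_prod F K us.
set e2 := \prod_(_ <- us) _ in eq_coef *; set S2 := \sum_(_ <- us) _.
set e1 := \prod_(_ <- ts) _ in eq_coef *; set S1 := \sum_(_ <- ts) _ => /= d2 d1.
have dvdP (p : {poly F}) : (forall k, (k < K)%N -> p`_k = 0) -> 'X^K %| p.
  move=> p0; rewrite -[p](poly_take_drop K) dvdp_add ?dvdp_mull //.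
  suff -> : take_poly K p = 0 by rewrite dvdp0.
  by apply/polyP => i; rewrite coef_take_poly coef0; case: ifP => // /p0.
have de : 'X^K %| e1 - e2.
  by apply: dvdP => i /ltnW lti; rewrite coefB eq_coef ?subrr.
(* Coefficient [i < K] of the derivative involves coefficient [i + 1], so agreement up to [K]
   inclusive is used. *)
have de' : 'X^K %| e1^`() - e2^`().
  by apply: dvdP => i lti; rewrite coefB !coef_deriv eq_coef ?subrr.
have cop : coprimep ('X^K) e1.
  apply: coprimep_expl; rewrite coprimep_sym -['X]subr0 -polyC0 coprimep_XsubC /root.
  rewrite /e1 horner_prod big1 ?oner_eq0 // => t _.
  by rewrite !hornerE.
have: 'X^K %| e1 * (S1 - S2).
  have -> : e1 * (S1 - S2) = (e1^`() - e2^`()) + (e2^`() - e2 * S2)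
      - (e1^`() - e1 * S1) - (e1 - e2) * S2 by ring.
  by apply: dvdp_sub; [apply: dvdp_sub => //; exact: dvdp_add | exact: dvdp_mulr].
rewrite Gauss_dvdpr // => dS.
have szS (vs : seq F) : (size (\sum_(t <- vs) \poly_(j < K) (t * (- t) ^+ j))%R <= K)%N.
  elim: vs => [|v vs IH]; rewrite ?big_nil ?size_poly0 // big_cons.
  by rewrite (leq_trans (size_polyD _ _)) // geq_max size_poly.
have eqS : S1 = S2.
  apply/eqP; rewrite -subr_eq0; apply/negPn/negP => nz.
  have := dvdp_leq nz dS; rewrite size_polyXn ltnNge.
  by rewrite (leq_trans (size_polyD _ _)) // geq_max size_polyN !szS.
have coefS (vs : seq F) :
    \sum_(t <- vs) t ^+ k.+1 =
    (-1) ^+ k * (\sum_(t <- vs) \poly_(j < K) (t * (- t) ^+ j))`_k.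
  rewrite coef_sum mulr_sumr; apply: eq_bigr => t _.
  by rewrite coef_poly ltkK exprS [(- t) ^+ _]exprNn [t * (_ * _)]mulrCA signrMK.
by rewrite !coefS -/S1 eqS.
Qed.

Lemma eq_sum_horner (F : fieldType) (K : nat) (q : {poly F}) (ts us : seq F) :
  (size q <= K.+1)%N -> size ts = size us ->
  (forall k, (0 < k <= K)%N -> \sum_(t <- ts) t ^+ k = \sum_(u <- us) u ^+ k) ->
  \sum_(t <- ts) q.[t] = \sum_(u <- us) q.[u].
Proof.
move=> szq eq_sz eq_pow.
have E (vs : seq F) : \sum_(v <- vs) q.[v] =
    \sum_(k < K.+1) q`_k * \sum_(v <- vs) v ^+ k.
  under eq_bigr do rewrite (horner_coef_wide _ szq).
  by rewrite exchange_big /=; apply: eq_bigr => k _; rewrite mulr_sumr.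
rewrite !E; apply: eq_bigr => -[[|k] /= ltk] _; congr (_ * _).
  (* The power sum of order 0 is the length of the list. *)
  by rewrite !big_const_seq !count_predT eq_sz.
exact: eq_pow.
Qed.

(** * Chebyshev polynomials and the series of the logarithm *)

Fixpoint chebyshev (F : nzRingType) (n : nat) : {poly F} :=
  if n is m.+1 then
    if m is l.+1 then 2%:P * 'X * chebyshev F m - chebyshev F l else 'X
  else 1.
Arguments chebyshev : simpl never.

Lemma chebyshevSS (F : nzRingType) (n : nat) :
  chebyshev F n.+2 = 2%:P * 'X * chebyshev F n.+1 - chebyshev F n.
Proof. by []. Qed.

Lemma size_chebyshev (F : nzRingType) (n : nat) :
  (size (chebyshev F n) <= n.+1)%N.
Proof.
suff: (size (chebyshev F n) <= n.+1)%N && (size (chebyshev F n.+1) <= n.+2)%N.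
  by case/andP.
elim: n => [|n /andP[IHn IHSn]]; first by rewrite size_poly1 size_polyX.
rewrite IHSn chebyshevSS (leq_trans (size_polyD _ _)) // geq_max size_polyN.
rewrite (leq_trans IHn) ?andbT; last by rewrite ltnW.
rewrite -mulrA mul_polyC (leq_trans (size_scale_leq _ _)) //.
rewrite -commr_polyX.
by have [->|nz] := eqVneq (chebyshev F n.+1) 0; rewrite ?mul0r ?size_poly0 ?size_mulX.
Qed.

Lemma chebyshev_cos (R : realType) (n : nat) (x : R) :
  (chebyshev R n).[cos x] = cos (n%:R * x).
Proof.
suff: (chebyshev R n).[cos x] = cos (n%:R * x) /\
      (chebyshev R n.+1).[cos x] = cos (n.+1%:R * x) by case.
elim: n => [|n [IHn IHSn]].
  by rewrite /chebyshev hornerC hornerX mul0r cos0 mul1r.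
split=> //; rewrite chebyshevSS !hornerE IHn IHSn.
have -> : n.+2%:R * x = n.+1%:R * x + x by rewrite -[n.+2]addn1 natrD mulrDl mul1r.
have -> : n%:R * x = n.+1%:R * x - x by rewrite -[n.+1]addn1 natrD; ring.
by rewrite cosB cosD; ring.
Qed.

Lemma norm_chebyshev_le1 (R : realType) (n : nat) (y : R) :
  -1 <= y <= 1 -> `|(chebyshev R n).[y]| <= 1.
Proof. by move=> hy; rewrite -(acosK hy) chebyshev_cos cos_max. Qed.

(* Multiplying out the generating function of the Chebyshev polynomials
   telescopes by the three-term recurrence. *)
Lemma chebyshev_generating (F : comNzRingType) (K : nat) (x y : F) :
  (1 + 2 * x * y + x ^+ 2) *
    \sum_(k < K) (-1) ^+ k * (chebyshev F k.+1).[y] * x ^+ k =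
  y + x - (-1) ^+ K * (x ^+ K * (chebyshev F K.+1).[y] +
                       x ^+ K.+1 * (chebyshev F K).[y]).
Proof.
elim: K => [|K IH].
  by rewrite big_ord0 /chebyshev hornerX hornerC; ring.
rewrite big_ord_recr /= mulrDr IH.
by rewrite chebyshevSS !hornerE /= !exprS; ring.
Qed.

(* The mean value theorem in [r]: by [chebyshev_generating] the [r]-derivative of
   the error is explicit and of order [r ^+ K]. *)
Lemma ln_chebyshev_approx (R : realType) (K : nat) (r y : R) :
  0 <= r < 1 -> -1 <= y <= 1 ->
  `|ln (1 + 2 * r * y + r ^+ 2) -
     \sum_(k < K) 2 * (-1) ^+ k / k.+1%:R * r ^+ k.+1 * (chebyshev R k.+1).[y]|
  <= 4 * r ^+ K.+1 / (1 - r) ^+ 2.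
Proof.
move=> /andP[r_ge0 r_lt1] hy; have /andP[y_ge y_le] := hy.
pose P : {poly R} := 1 + (2 * y) *: 'X + 'X^2.
pose S : {poly R} :=
  \sum_(k < K) (2 * (-1) ^+ k / k.+1%:R * (chebyshev R k.+1).[y]) *: 'X^(k.+1).
have PE x : P.[x] = 1 + 2 * x * y + x ^+ 2 by rewrite !hornerE; ring.
have SE x : S.[x] = \sum_(k < K) 2 * (-1) ^+ k / k.+1%:R * x ^+ k.+1 *
                      (chebyshev R k.+1).[y].
  by rewrite horner_sum; apply: eq_bigr => k _; rewrite !hornerE; ring.
have dPE x : P^`().[x] = 2 * (y + x).
  by rewrite /P -polyC1 !derivD derivC derivZ derivX derivXn !hornerE /=; ring.
have dSE x : S^`().[x] =
    2 * \sum_(k < K) (-1) ^+ k * (chebyshev R k.+1).[y] * x ^+ k.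
  rewrite linear_sum horner_sum mulr_sumr; apply: eq_bigr => k _.
  rewrite /= derivZ derivXn !hornerZ hornerMn hornerXn -[x ^+ _ *+ _]mulr_natr succnK.
  have : k.+1%:R != 0 :> R by rewrite pnatr_eq0.
  by set c : R := k.+1%:R => c_neq0; field.
(* Here [P(x) = (1 - x)^2 + 2 x (1 + y)], with [y >= -1]. *)
have P_ge x : 0 <= x <= r -> (1 - r) ^+ 2 <= P.[x].
  by move=> /andP[x_ge0 x_le]; rewrite PE; nra.
have r1 : 0 < (1 - r) ^+ 2 by rewrite exprn_gt0 ?subr_gt0.
have P_gt0 x : 0 <= x <= r -> 0 < P.[x].
  by move=> /P_ge; apply: lt_le_trans.
pose f := (@ln R \o horner P) - horner S.
pose df x := P.[x]^-1 * P^`().[x] - S^`().[x].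
have f_df x : 0 <= x <= r -> is_derive x 1 f (df x).
  move=> hx; apply: is_deriveB; apply: is_derive1_comp.
  exact: is_derive1_ln (P_gt0 _ hx).
have [||c cr fE] := @MVT_segment R f df 0 r r_ge0.
- by move=> x; rewrite in_itv /= => /andP[x0 xr]; apply: f_df; rewrite !ltW.
- apply: derivable_within_continuous => x; rewrite in_itv /= => hx.
  by have [] := f_df _ hx.
have f0 : f 0 = 0.
  rewrite /f /= !fctE PE SE /= mulr0 mul0r expr0n !addr0 ln1 sub0r big1 ?oppr0 //.
  by move=> k _; rewrite expr0n mulr0 mul0r.
rewrite -PE -SE.
have -> : ln P.[r] - S.[r] = df c * r by rewrite -[r in RHS]subr0 -fE f0 subr0.
move: cr; rewrite in_itv /= => cr; have /andP[c0 c_le] := cr.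
have -> : df c = 2 * ((-1) ^+ K * (c ^+ K * (chebyshev R K.+1).[y] +
                       c ^+ K.+1 * (chebyshev R K).[y])) / P.[c].
  have := chebyshev_generating R K c y; rewrite -PE.
  set G := \sum_(_ < _) _ => eqG; have nz := P_gt0 _ cr.
  rewrite /df dPE dSE -/G; set u := (-1) ^+ K * _ in eqG *.
  have -> : u = y + c - P.[c] * G by rewrite eqG; ring.
  by field; rewrite gt_eqF.
have cK : c ^+ K <= r ^+ K by rewrite lerXn2r ?nnegrE.
have cK0 : 0 <= c ^+ K by rewrite exprn_ge0.
(* Both remainder terms are bounded by [r ^+ K]; the length [r] of the interval in the mean value
   theorem restores the exponent [K.+1]. *)
have cK1 : c ^+ K.+1 <= r ^+ K.
  by rewrite exprS (le_trans _ cK) // ler_piMl // (le_trans c_le) ?ltW.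
have cK10 : 0 <= c ^+ K.+1 by rewrite exprn_ge0.
rewrite !normrM normrX normrN1 expr1n mul1r normfV.
rewrite (ger0_norm r_ge0) (gtr0_norm (P_gt0 _ cr)) ger0_norm //.
set N := `|_ + _|; have N_le : N <= 2 * r ^+ K.
  rewrite /N (le_trans (ler_normD _ _)) // !normrM (ger0_norm cK0) (ger0_norm cK10).
  rewrite mulr_natl mulr2n.
  by apply: lerD; rewrite -[leRHS]mulr1 ler_pM ?norm_chebyshev_le1.
rewrite mulrAC ler_pM ?invr_ge0 ?mulr_ge0 ?normr_ge0 ?(ltW (P_gt0 _ _)) //.
  by rewrite exprS; nra.
by rewrite lef_pV2 ?posrE ?P_gt0 ?P_ge.
Qed.

(** * Polynomial approximation of [ln (1 + t)] *)

Lemma ln1D_chebyshev_approx (R : realType) (K : nat) (delta : R) :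
  0 < delta ->
  let M := Num.sqrt (1 + delta^-1) in
  exists2 q : {poly R}, (size q <= K.+1)%N &
    forall t, 0 <= t <= delta^-1 ->
      `|ln (1 + t) - q.[t]| <= (M + 1) ^+ 2 * ((M - 1) / (M + 1)) ^+ K.+1.
Proof.
move=> delta_gt0 M.
have delta_neq0 := lt0r_neq0 delta_gt0.
have M_sqr : M ^+ 2 = 1 + delta^-1 by rewrite sqr_sqrtr ?addr_ge0 ?invr_ge0 ?ltW.
have deltaV : delta^-1 = M ^+ 2 - 1 by rewrite M_sqr addrAC subrr add0r.
have deltaV_gt0 : 0 < delta^-1 by rewrite invr_gt0.
have M_gt1 : 1 < M.
  have : 0 <= M by apply: sqrtr_ge0.
  by rewrite deltaV in deltaV_gt0; nra.
set r := (M - 1) / (M + 1).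
have M1_neq0 : M + 1 != 0 by rewrite gt_eqF //; lra.
have r_bd : 0 <= r < 1.
  by rewrite divr_ge0 ?ltr_pdivrMr ?mul1r; lra.
pose aff : {poly R} := (2 * delta) *: 'X - 1.
have affE t : aff.[t] = 2 * delta * t - 1 by rewrite !hornerE.
pose c k : R := 2 * (-1) ^+ k / k.+1%:R * r ^+ k.+1.
(* With [y = 2 delta t - 1] and [delta^-1 = M^2 - 1], one has [1 + t = (M + 1)^2 / 4 * (1 + 2 r y +
   r^2)]; the constant term is the logarithm of the first factor. *)
exists ((ln ((M + 1) ^+ 2 / 4))%:P +
        \sum_(k < K) c k *: (chebyshev R k.+1 \Po aff)).
  rewrite (leq_trans (size_polyD _ _)) // geq_max (leq_trans (size_polyC_leq1 _)) //=.
  rewrite (leq_trans (size_sum _ _ _)) //; apply/bigmax_leqP => k _.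
  rewrite (leq_trans (size_scale_leq _ _)) // (leq_trans (size_comp_poly_leq _ _)) //.
  have size_aff : (size aff <= 2)%N.
    rewrite (leq_trans (size_polyD _ _)) // geq_max size_polyN size_poly1 andbT.
    by rewrite (leq_trans (size_scale_leq _ _)) ?size_polyX.
  have size_k : ((size (chebyshev R k.+1)).-1 <= k.+1)%N.
    by have := size_chebyshev R k.+1; case: (size _).
  rewrite ltnS (leq_trans (leq_mul size_k (_ : _ <= 1)%N)) ?muln1 //.
  by case: (size aff) size_aff.
move=> t /andP[t_ge0 t_le].
have y_bd : -1 <= aff.[t] <= 1.
  have : 0 <= delta * t <= 1.
    by rewrite mulr_ge0 ?(ltW delta_gt0) //= mulrC -ler_pdivlMr // mul1r.
  by rewrite affE; lra.
have -> : (M + 1) ^+ 2 * r ^+ K.+1 = 4 * r ^+ K.+1 / (1 - r) ^+ 2.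
  have -> : 1 - r = 2 / (M + 1) by rewrite /r; field.
  by field.
apply: le_trans (ln_chebyshev_approx R K r _ r_bd y_bd); rewrite le_eqVlt.
apply/orP; left; apply/eqP; congr `|_|.
rewrite hornerD hornerC horner_sum opprD addrA; congr (_ - _); last first.
  by apply: eq_bigr => k _; rewrite hornerZ horner_comp.
have pos : 0 < 1 + 2 * r * aff.[t] + r ^+ 2.
  have : 0 < (1 - r) ^+ 2 by rewrite exprn_gt0 //; lra.
  by case/andP: r_bd; nra.
rewrite -ln_div ?posrE //; last 2 first.
- by lra.
- by rewrite divr_gt0 ?exprn_gt0 //; lra.
congr ln; rewrite affE.
have -> : delta = (M ^+ 2 - 1)^-1 by rewrite -deltaV invrK.
rewrite /r; field.
have : M ^+ 2 - 1 != 0 by rewrite -deltaV invr_eq0.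
by move=> ->; rewrite M1_neq0.
Qed.

(** Let [s = sqrt delta] and [L] be the logarithm. Since [(M + 1) s <= 3], the constant 513 yields
    [r ^+ K.+1 <= exp (- 342 L)]. Of this, [exp (- 2 L) = (eps s / n)^2] absorbs the prefactor
    [(M + 1)^2 <= 9 / s^2], and [exp (- 340 L) <= 1/18] when [L >= 1/20]. *)
Lemma ln1D_poly_approx (R : realType) (n : nat) (delta eps : R) :
  (1 <= n)%N -> 0 < delta < 1 -> 0 < eps < 1 ->
  exists2 q : {poly R},
    (size q <= (Num.truncn (513 / Num.sqrt delta *
                  ln (n%:R / (eps * Num.sqrt delta)))).+1)%N &
    forall t, 0 <= t <= delta^-1 -> `|ln (1 + t) - q.[t]| <= eps / (2 * n%:R).
Proof.
move=> n_ge1 /andP[delta_gt0 delta_lt1] /andP[eps_gt0 eps_lt1].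
set s := Num.sqrt delta; set L := ln _; set K := Num.truncn _.
have s_gt0 : 0 < s by rewrite sqrtr_gt0.
have s_sqr : s ^+ 2 = delta by rewrite sqr_sqrtr ?ltW.
have s_lt1 : s < 1 by rewrite -sqrtr1 ltr_sqrt.
have n1 : 1 <= n%:R :> R by rewrite ler1n.
have n_gt0 : 0 < n%:R :> R by lra.
have es_gt0 : 0 < eps * s by rewrite mulr_gt0.
have expL : expR L = n%:R / (eps * s) by rewrite lnK // posrE divr_gt0.
have [L_ge|L_lt] := leP (20^-1) L; last first.
  (* Here [n = 1] and [eps], [delta] are so close to [1] that a constant does,
     even when [K = 0]. *)
  have es_big : 19 / 20 * n%:R <= eps * s.
    have : 19 / 20 <= expR (- L).
      by apply: le_trans (expR_ge1Dx _); lra.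
    by rewrite expRN expL invf_div ler_pdivlMr.
  have [n_eq1|n_gt1] := leqP n 1; last first.
    have : 2 <= n%:R :> R by rewrite ler_nat.
    by nra.
  have n1E : n%:R = 1 :> R by rewrite (_ : n = 1%N) //; apply/eqP; rewrite eqn_leq n_eq1.
  rewrite n1E mulr1 in es_big; rewrite n1E mulr1.
  have eps_big : 19 / 20 <= eps by nra.
  have s_big : 19 / 20 <= s by nra.
  (* This follows from [1 + delta^-1 <= 17/8 <= (1 + eps/2)^2 <= exp eps]. *)
  have bound : ln (1 + delta^-1) <= eps.
    rewrite -[leRHS]expRK ler_ln ?posrE ?expR_gt0 ?addr_gt0 ?invr_gt0 //.
    have -> : eps = 2%:R * (eps / 2) by field.
    rewrite expRM_natl.
    have : 1 + eps / 2 <= expR (eps / 2) by apply: expR_ge1Dx.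
    have : delta^-1 <= 9 / 8.
      by rewrite -[leLHS]mul1r ler_pdivrMr // -s_sqr; nra.
    by nra.
  (* The midpoint of the range [[0, ln (1 + delta^-1)]] is within [eps / 2] of all its values. *)
  exists (ln (1 + delta^-1) / 2)%:P; first by rewrite (leq_trans (size_polyC_leq1 _)).
  move=> t /andP[t_ge0 t_le]; rewrite hornerC.
  have : ln (1 + t) <= ln (1 + delta^-1) by rewrite ler_ln ?posrE; lra.
  have : 0 <= ln (1 + t) by rewrite ln_ge0; lra.
  by rewrite ler_norml; lra.
have [q size_q approx_q] := ln1D_chebyshev_approx R K _ delta_gt0.
exists q => // t /approx_q /le_trans; apply.
set M := Num.sqrt _.
have M_ge0 : 0 <= M by apply: sqrtr_ge0.
have M_sqr : M ^+ 2 = 1 + delta^-1 by rewrite sqr_sqrtr ?addr_ge0 ?invr_ge0 ?ltW.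
have Ms_le : (M + 1) * s <= 3.
  have : (M * s) ^+ 2 = delta + 1.
    by rewrite exprMn M_sqr s_sqr mulrDl mul1r mulVf ?gt_eqF.
  rewrite mulrDl mul1r; have : 0 <= M * s by rewrite mulr_ge0 // ltW.
  by move: (M * s) => z z_ge0 z_sqr; nra.
have M1_gt0 : 0 < M + 1 by lra.
have r_le : (M - 1) / (M + 1) <= expR (- (2 / (M + 1))).
  rewrite -[leLHS](_ : 1 + - (2 / (M + 1)) = _) ?expR_ge1Dx //.
  by field; rewrite gt_eqF.
have M_ge1 : 1 <= M.
  have : 0 < delta^-1 by rewrite invr_gt0.
  by nra.
(* The bounds below only need [L >= 1/20] and [1 + m * L >= 18]. *)
have [m mE cE] : exists2 m : R, m / 20 = 17 & 513 = 3 / 2 * (m + 2).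
  by exists (17 * 20); lra.
have m_ge0 : 0 <= m by lra.
have pow_le : ((M - 1) / (M + 1)) ^+ K.+1 <= expR (- ((m + 2) * L)).
  apply: (@le_trans _ _ (expR (- (2 / (M + 1))) ^+ K.+1)).
    by rewrite lerXn2r ?nnegrE ?expR_ge0 // divr_ge0; lra.
  rewrite -expRM_natl ler_expR mulrN lerN2.
  (* Rounding down costs nothing, since degree [K] already gives the exponent [K.+1]. *)
  have K_gt : 3 / 2 * (m + 2) / s * L < K.+1%:R.
    by rewrite -cE; apply: truncnS_gt.
  apply: (@le_trans _ _ (3 / 2 * (m + 2) / s * L * (2 / (M + 1)))).
    rewrite [leRHS](_ : _ = (m + 2) * L * (3 / ((M + 1) * s))); last first.
      by field; rewrite !gt_eqF.
    have mL_ge0 : 0 <= (m + 2) * L by rewrite mulr_ge0 //; lra.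
    by rewrite ler_peMr // ler_pdivlMr ?mul1r ?mulr_gt0.
  by rewrite ler_wpM2r ?(ltW K_gt) // divr_ge0 ?ltW.
clear cE; have exp_18 : expR (- (m * L)) <= 18^-1.
  rewrite expRN lef_pV2 ?posrE ?expR_gt0 //.
  apply: (@le_trans _ _ (1 + m * L)); last exact: expR_ge1Dx.
  rewrite (_ : 18 = 1 + 17); last by ring.
  by rewrite lerD2l -mE ler_wpM2l.
apply: (@le_trans _ _ (9 / delta * expR (- ((m + 2) * L)))).
  apply: ler_pM pow_le; first by rewrite exprn_ge0 // ltW.
    by rewrite exprn_ge0 // divr_ge0 ?(ltW M1_gt0) // subr_ge0.
  rewrite ler_pdivlMr // -s_sqr -exprMn (_ : 9 = 3 ^+ 2); last by rewrite expr2; ring.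
  by rewrite lerXn2r ?nnegrE ?mulr_ge0 // ltW.
have -> : - ((m + 2) * L) = 2%:R * (- L) + - (m * L) by ring.
rewrite expRD expRM_natl expRN expL -s_sqr.
apply: (@le_trans _ _ (9 / s ^+ 2 * ((n%:R / (eps * s))^-1 ^+ 2 * 18^-1))).
  apply: ler_wpM2l; first by rewrite divr_ge0 // exprn_ge0 // ltW.
  by apply: ler_wpM2l => //; apply: sqr_ge0.
rewrite [leLHS](_ : _ = eps / (2 * n%:R) * (eps / n%:R)); last first.
  by field; rewrite !gt_eqF.
apply: ler_piMr.
  by rewrite divr_ge0 ?(ltW eps_gt0) // mulr_ge0 // ltW.
by rewrite ler_pdivrMr // mul1r (le_trans _ n1) // ltW.
Qed.

(** * Complex logarithms and factorization over the roots *)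

Lemma cexp_surj (R : realType) (a : R[i]) : a != 0 -> exists z, a = cexp z.
Proof.
case: a => x y nz.
have sqr_gt0 : 0 < x ^+ 2 + y ^+ 2.
  rewrite lt_def addr_ge0 ?sqr_ge0 // andbT paddr_eq0 ?sqr_ge0 // !sqrf_eq0.
  by move: nz; rewrite eq_complex.
pose rho := Num.sqrt (x ^+ 2 + y ^+ 2).
have rho_gt0 : 0 < rho by rewrite sqrtr_gt0.
have rho_neq0 := lt0r_neq0 rho_gt0.
have rho_sqr : rho ^+ 2 = x ^+ 2 + y ^+ 2 by rewrite sqr_sqrtr ?ltW.
pose u := x / rho; pose v := y / rho.
have uv1 : 1 - u ^+ 2 = v ^+ 2.
  have -> : 1 = rho ^+ 2 / rho ^+ 2 by rewrite divff ?sqrf_eq0.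
  by rewrite {1}rho_sqr /u /v; field.
have u_bd : -1 <= u <= 1 by have := sqr_ge0 v; rewrite -uv1; nra.
have sin_u : sin (acos u) = `|v| by rewrite sin_acos // uv1 sqrtr_sqr.
suff [theta [cosE sinE]] : exists theta, cos theta = u /\ sin theta = v.
  exists (ln rho +i* theta); rewrite /cexp /= lnK ?posrE // cosE sinE.
  apply/eqP; rewrite eq_complex /= !mul0r subr0 addr0.
  by rewrite /u /v !(mulrC rho) !divfK ?eqxx.
(* [acos] yields a nonnegative sine, so the sign of [v] decides the sign of the angle. *)
have [v_ge0|v_lt0] := leP 0 v.
  by exists (acos u); rewrite acosK // sin_u ger0_norm.
by exists (- acos u); rewrite cosN acosK // sinN sin_u ltr0_norm // opprK.
Qed.

(** A root [z] gives [t = - 1 / z], because [X - z = - z (1 + t X)]. Padding with [t = 0] makes the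
    length [n] whatever the degree, and evaluation at 0 identifies the scalar. *)
Lemma poly_real_neg_roots (R : realType) (delta : R) (n : nat) (p : {poly R[i]}) :
  0 < delta -> p != 0 -> (size p <= n.+1)%N ->
  (forall x, root p x -> complex.Im x = 0 /\ complex.Re x <= - delta) ->
  exists ts : seq R,
    [/\ size ts = n, {in ts, forall t, 0 <= t <= delta^-1} &
        p = p`_0 *: map_poly (real_complex R) (\prod_(t <- ts) (1 + t *: 'X))].
Proof.
move=> delta_gt0 p_neq0 size_p roots_p.
have [r pE] := closed_field_poly_normal p.
have lead_p : lead_coef p != 0 by rewrite lead_coef_eq0.
have size_r : (size r <= n)%N.
  by move: size_p; rewrite pE size_scale // size_prod_XsubC.
have roots_r z : z \in r -> complex.Im z = 0 /\ complex.Re z <= - delta.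
  by move=> zr; apply: roots_p; rewrite pE rootZ // root_prod_XsubC.
have [ts [c [size_ts ts_bd prodE]]] : exists ts c,
    [/\ size ts = size r, {in ts, forall t, 0 <= t <= delta^-1} &
        \prod_(z <- r) ('X - z%:P) =
        c *: map_poly (real_complex R) (\prod_(t <- ts) (1 + t *: 'X))].
  elim: r {pE size_r} roots_r => [|z r IH] roots_r.
    by exists [::], 1; split=> //; rewrite !big_nil rmorph1 scale1r.
  have [|ts [c [size_ts ts_bd prodE]]] := IH.
    by move=> w wr; apply: roots_r; rewrite inE wr orbT.
  have [Im_z Re_z] := roots_r z (mem_head _ _).
  exists ((- complex.Re z)^-1 :: ts), (- z * c); split=> /=.
  - by rewrite size_ts.
  - move=> t; rewrite inE => /orP[/eqP->|/ts_bd//].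
    by rewrite invr_ge0 lef_pV2 ?posrE; lra.
  - have zE : z = (complex.Re z)%:C.
      by apply/eqP; rewrite eq_complex /= Im_z !eqxx.
    have z_neq0 : z != 0.
      by rewrite zE (_ : 0 = 0%:C) // (inj_eq (@complexI R)) lt_eqF //; lra.
    rewrite !big_cons prodE rmorphM /= rmorphD /= rmorph1 map_polyZ map_polyX /=.
    have -> : 'X - z%:P = - z *: (1 + ((- complex.Re z)^-1)%:C *: 'X).
      rewrite scalerDr scalerA rmorphV ?unitfE /=; last by rewrite lt0r_neq0 //; lra.
      rewrite rmorphN /= -zE divff ?oppr_eq0 // scale1r addrC.
      by rewrite -[_ *: 1]mul_polyC mulr1 polyCN.
    by rewrite -scalerAl -scalerAr scalerA.
exists (ts ++ nseq (n - size r) 0); split.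
- by rewrite size_cat size_nseq size_ts subnKC.
- move=> t; rewrite mem_cat => /orP[/ts_bd//|/nseqP[-> _]].
  by rewrite lexx invr_ge0 ltW.
rewrite big_cat /= [X in _ * X]big1_seq ?mulr1; last first.
  by move=> t /nseqP[-> _]; rewrite scale0r addr0.
have -> : p`_0 = lead_coef p * c.
  rewrite {1}pE prodE scalerA coefZ coef_map /= -horner_coef0 horner_prod.
  by rewrite big1 ?rmorph1 ?mulr1 // => t _; rewrite !hornerE.
by rewrite {1}pE prodE scalerA.
Qed.

(** * Comparison of two polynomials with a common prefix *)

Lemma dist_sum_le (R : realType) (f g : R -> R) (eta : R) (ts us : seq R) :
  size ts = size us -> \sum_(t <- ts) g t = \sum_(u <- us) g u ->
  {in ts, forall t, `|f t - g t| <= eta} ->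
  {in us, forall u, `|f u - g u| <= eta} ->
  `|\sum_(t <- ts) f t - \sum_(u <- us) f u| <= 2 * (size ts)%:R * eta.
Proof.
move=> eq_sz eq_sum ts_eta us_eta.
have sum_le (vs : seq R) : {in vs, forall v, `|f v - g v| <= eta} ->
    `|\sum_(v <- vs) f v - \sum_(v <- vs) g v| <= (size vs)%:R * eta.
  move=> vs_eta; rewrite -sumrB (le_trans (ler_norm_sum _ _ _)) //.
  have -> : (size vs)%:R * eta = \sum_(v <- vs) eta.
    by rewrite big_const_seq count_predT iter_addr_0 mulr_natl.
  rewrite big_seq [leRHS]big_seq.
  by apply: ler_sum => v /vs_eta.
have := sum_le _ ts_eta; have := sum_le _ us_eta; rewrite -eq_sz -eq_sum.
by rewrite !ler_norml => /andP[? ?] /andP[? ?]; apply/andP; split; lra.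
Qed.

Theorem theorem1p1 (R : realType) :
  exists2 c : R, 0 < c &
    forall (n : nat) (delta eps : R),
      (1 <= n)%N -> 0 < delta < 1 -> 0 < eps < 1 ->
      (* the argument is nonnegative, so Num.truncn is the floor, as a nat *)
      let K := Num.truncn (c / Num.sqrt delta *
                           ln (n%:R / (eps * Num.sqrt delta))) in
      exists Phi : 'rV[R[i]]_K.+1 -> R[i],
        (forall v, Phi v != 0) /\
        forall p : {poly R[i]},
          p != 0 -> (size p <= n.+1)%N ->
          (forall x : R[i], root p x ->
             complex.Im x = 0 /\ complex.Re x <= - delta) ->
          approximates eps (Phi (\row_(k < K.+1) p`_k)) p.[1].
Proof.
exists 513 => // n delta eps n_ge1 delta_bd eps_bd K.
have delta_gt0 : 0 < delta by case/andP: delta_bd.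
have [q size_q approx_q] := ln1D_poly_approx R n delta eps n_ge1 delta_bd eps_bd.
pose good (p : {poly R[i]}) := [/\ p != 0, (size p <= n.+1)%N &
  forall x, root p x -> complex.Im x = 0 /\ complex.Re x <= - delta].
pose has_prefix (v : 'rV[R[i]]_K.+1) (p : {poly R[i]}) :=
  good p /\ \row_(k < K.+1) p`_k = v.
(* The default 1 keeps [Phi] nonzero on prefixes of no admissible polynomial. *)
pose Phi v := if pselect (exists p, has_prefix v p) is left ex
              then (sval (cid ex)).[1] else 1.
exists Phi; split=> [v|p p_neq0 size_p roots_p].
  rewrite /Phi; case: pselect => [ex|_]; last exact: oner_neq0.
  (* An admissible polynomial does not vanish at 1, since [1 > - delta]. *)
  case: cid => p /= [[_ _ roots_p] _]; apply/negP => /roots_p /= [_].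
  by lra.
rewrite /Phi; case: pselect => [ex|[]]; last by exists p.
case: cid => p' /= [[p'_neq0 size_p' roots_p'] eq_row].
have [ts [size_ts ts_bd pE]] :=
  poly_real_neg_roots R delta n p delta_gt0 p_neq0 size_p roots_p.
have [us [size_us us_bd p'E]] :=
  poly_real_neg_roots R delta n p' delta_gt0 p'_neq0 size_p' roots_p'.
have eq_coef k : (k <= K)%N -> p'`_k = p`_k.
  move=> le_kK; have /rowP/(_ (Ordinal (le_kK : (k < K.+1)%N))) := eq_row.
  by rewrite !mxE.
have p0_neq0 : p`_0 != 0.
  by apply: contra p_neq0 => /eqP p0; rewrite pE p0 scale0r.
have eq_sum : \sum_(t <- ts) q.[t] = \sum_(u <- us) q.[u].
  apply: (eq_sum_horner _ K) => //; first by rewrite size_ts size_us.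
  apply: power_sums_of_coefs => k le_kK; have := eq_coef k le_kK.
  (* The common constant coefficient is nonzero and cancels, leaving the coefficients of the two
     products. *)
  rewrite pE p'E eq_coef // !coefZ !coef_map /= => /(mulfI p0_neq0) /complexI.
  by [].
have value (vs : seq R) : {in vs, forall v, 0 <= v <= delta^-1} ->
    (map_poly (real_complex R) (\prod_(v <- vs) (1 + v *: 'X))).[1] =
    (expR (\sum_(v <- vs) ln (1 + v)))%:C.
  move=> vs_bd; rewrite -(rmorph1 (real_complex R)) horner_map /=; congr _%:C.
  rewrite horner_prod expR_sum big_seq [RHS]big_seq.
  apply: eq_bigr => v /vs_bd/andP[v_ge0 _].
  by rewrite !hornerE lnK // posrE; lra.
have [z zE] := cexp_surj R p`_0 p0_neq0.
have cexpD (S : R) : cexp (z + S%:C) = cexp z * (expR S)%:C.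
  rewrite /cexp; case: z {zE} => x y /=; rewrite expRD addr0 rmorphM /=.
  by rewrite mulrAC.
exists (z + (\sum_(t <- ts) ln (1 + t))%:C), (z + (\sum_(u <- us) ln (1 + u))%:C).
rewrite !cexpD -zE; split.
- by rewrite {1}pE hornerZ value.
- by rewrite {1}p'E hornerZ value // eq_coef.
rewrite [z + _]addrC addrKA -rmorphB normc_def /= expr0n addr0 sqrtr_sqr lecR.
have -> : eps = 2 * (size ts)%:R * (eps / (2 * n%:R)).
  by rewrite size_ts; field; rewrite pnatr_eq0 -lt0n.
apply: (dist_sum_le _ _ (horner q)); rewrite ?size_ts ?size_us //.
- by move=> t /ts_bd/approx_q.
- by move=> u /us_bd/approx_q.
Qed.
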